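(* Let $\mathcal{S}\subset\mathcal{D}$ be a sparse collection of dyadic cubes in $\mathbb{R}^n$ with Carleson constant $\Lambda>1$ and with no infinitely increasing chains, and let $$\widetilde b_{\mathcal{S}}:=\sum_{Q\in\mathcal{S}}\sum_{\epsilon\not\equiv1}\sqrt{|Q|}\,h_Q^\epsilon .$$ Then $\widetilde b_{\mathcal{S}}\in BMO^{\mathcal{D}}(\mathbb{R}^n)$ with $\|\widetilde b_{\mathcal{S}}\|_{BMO^{\mathcal{D}}}\le\sqrt{(2^n-1)\Lambda}$, and the sparse operator $\mathcal{A}_{\mathcal{S}}f:=\sum_{Q\in\mathcal{S}}\langle f\rangle_Q\mathbf{1}_Q$ satisfies $$\mathcal{A}_{\mathcal{S}}f=\frac1{2^n-1}\,\Pi^*_{\widetilde b_{\mathcal{S}}}\Pi_{\widetilde b_{\mathcal{S}}}f\qquad\text{a.e., for every locally integrable } f.$$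
   Context: $\mathcal{D}$ is a fixed dyadic grid on $\mathbb{R}^n$: a collection of cubes with side lengths $2^k$, $k\in\mathbb{Z}$, such that for each fixed $k$ the cubes of side length $2^k$ partition $\mathbb{R}^n$, and $P\cap Q\in\{P,Q,\emptyset\}$ for all $P,Q\in\mathcal{D}$. $\mathcal{S}\subset\mathcal{D}$ has Carleson constant $\Lambda>1$ (is $\Lambda$-Carleson) if $\sum_{P\in\mathcal{S},P\subset Q}|P|\le\Lambda|Q|$ for all $Q\in\mathcal{D}$; it is sparse if it is $\Lambda$-Carleson for some $\Lambda>1$. $\mathcal{S}$ has an infinitely increasing chain if there are $Q_k\in\mathcal{S}$, $k\in\mathbb{N}$, with $Q_k\subsetneq Q_{k+1}$ for all $k$. (For such $\mathcal{S}$ almost every point lies in only finitely many elements of $\mathcal{S}$.) Haar functions: for an interval $I$, $h_I^0=|I|^{-1/2}(\mathbf{1}_{I_+}-\mathbf{1}_{I_-})$ ($I_\pm$ the right/left halves) and $h_I^1=|I|^{-1/2}\mathbf{1}_I$; for $Q=I_1\times\dots\times I_n\in\mathcal{D}$ and $\epsilon\in\{0,1\}^n$, $h_Q^\epsilon(x)=\prod_kh_{I_k}^{\epsilon_k}(x_k)$, cancellative when $\epsilon\not\equiv1$. $\langle f\rangle_Q=\frac1{|Q|}\int_Qf\,dx$, $(f,g)=\int fg\,dx$, $\|b\|_{BMO^{\mathcal{D}}}=\sup_{Q\in\mathcal{D}}\frac1{|Q|}\int_Q|b-\langle b\rangle_Q|\,dx$. $\Pi_a^*\Pi_bf:=\sum_{Q\in\mathcal{D}}\sum_{\epsilon\not\equiv1}(a,h_Q^\epsilon)(b,h_Q^\epsilon)\langle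 f\rangle_Q\frac{\mathbf{1}_Q}{|Q|}$, the composition of the paraproducts $\Pi_bf=\sum_{Q,\epsilon\not\equiv1}(b,h_Q^\epsilon)\langle f\rangle_Qh_Q^\epsilon$ and $\Pi_a^*f=\sum_{Q,\epsilon\not\equiv1}(a,h_Q^\epsilon)(f,h_Q^\epsilon)\frac{\mathbf{1}_Q}{|Q|}$. *)

(* Defs.v *)
From HB Require Import structures.
From mathcomp Require Import all_boot all_order all_algebra.
From mathcomp Require Import all_classical all_reals all_analysis.
Import Order.TTheory GRing.Theory Num.Theory.
Import numFieldNormedType.Exports.

Set Implicit Arguments.
Unset Strict Implicit.
Unset Printing Implicit Defensive.

Local Open Scope classical_set_scope.
Local Open Scope ring_scope.

(* Points of R^n are n-tuples, which carry the product (Borel) sigma-algebra.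
   Lebesgue measure on R^n is built by iterating the product measure:
   R^0 carries the Dirac mass, and R^n.+1 the image of R * R^n under cons. *)
Section lebesgue_measure_Rn.
Context {R : realType}.

Definition cons_pt n (p : measurableTypeR R * n.-tuple R) :
    n.+1.-tuple R :=
  [tuple of p.1 :: p.2].

Lemma measurable_cons_pt n : measurable_fun setT (@cons_pt n).
Proof.
apply: measurable_cons; last exact: measurable_snd.
move=> _ Y mY; exact: (@measurable_fst _ _ (measurableTypeR R) _ measurableT).
Qed.

Section step.
Variables (n : nat) (m : {sigma_finite_measure set (n.-tuple R) -> \bar R}).

Definition lebesgue_step : set (n.+1.-tuple R) -> \bar R :=
  pushforward (@lebesgue_measure R \x m)%E (@cons_pt n).

Let step0 : lebesgue_step set0 = 0%E.
Proof. by rewrite /lebesgue_step /pushforward preimage_set0 measure0. Qed.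

Let step_ge0 A : (0 <= lebesgue_step A)%E.
Proof. by rewrite /lebesgue_step /pushforward measure_ge0. Qed.

Let step_sigma_additive : semi_sigma_additive lebesgue_step.
Proof.
exact: (@measure_semi_sigma_additive _ _ _
  (measure_function_pushforward__canonical__measure_function_Measure
    (@lebesgue_measure R \x m)%E (@measurable_cons_pt n))).
Qed.

HB.instance Definition _ := isMeasure.Build _ _ _ lebesgue_step
  step0 step_ge0 step_sigma_additive.

Lemma lebesgue_step_sigma_finite : sigma_finite setT lebesgue_step.
Proof.
have /sigma_finiteP[F [FT ndF Foo]] := sigma_finiteT (@lebesgue_measure R).
have /sigma_finiteP[G [GT ndG Goo]] := sigma_finiteT m.
pose hd (t : n.+1.-tuple R) : measurableTypeR R := thead t.
pose tl (t : n.+1.-tuple R) : n.-tuple R := [tuple of behead t].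
exists (fun k => hd @^-1` F k `&` tl @^-1` G k).
  apply/seteqP; split => // t _.
  have [i _ Fi] : (\bigcup_i F i) (hd t) by rewrite -FT.
  have [j _ Gj] : (\bigcup_i G i) (tl t) by rewrite -GT.
  exists (maxn i j) => //; split.
    by apply: (subsetPset _ _ (ndF _ _ (leq_maxl i j))).
  by apply: (subsetPset _ _ (ndG _ _ (leq_maxr i j))).
move=> k; have [mF Fk] := Foo k; have [mG Gk] := Goo k; split.
  apply: measurableI.
    by rewrite -[X in measurable X]setTI; exact: (measurable_tnth ord0).
  by rewrite -[X in measurable X]setTI; exact: measurable_behead.
rewrite /lebesgue_step /pushforward (_ : _ @^-1` _ = F k `*` G k).
  by rewrite product_measure1E// lte_mul_pinfty// ge0_fin_numE.
apply/seteqP; split => -[a t] /=; rewrite /hd /tl /cons_pt theadE/=.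
  by move=> [Fa Gt]; split => //; move: Gt; congr (G k _); apply/val_inj.
by move=> [Fa Gt]; split => //; move: Gt; congr (G k _); apply/val_inj.
Qed.

HB.instance Definition _ := Measure_isSigmaFinite.Build _ _ _ lebesgue_step
  lebesgue_step_sigma_finite.

End step.

Lemma dirac_sigma_finite n (t : n.-tuple R) : sigma_finite setT (@dirac _ _ t R).
Proof.
by apply: fin_num_fun_sigma_finite => [|A mA]; rewrite ?measure0// diracE.
Qed.

HB.instance Definition _ n (t : n.-tuple R) := Measure_isSigmaFinite.Build _ _ _
  (@dirac _ _ t R) (@dirac_sigma_finite n t).

Fixpoint lebesgue_Rn n : {sigma_finite_measure set (n.-tuple R) -> \bar R} :=
  match n with
  | 0 => @dirac _ _ [tuple] R
  | n'.+1 => lebesgue_step (lebesgue_Rn n')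
  end.

Lemma lebesgue_Rn_box n (A : 'I_n -> set R) : (forall i, measurable (A i)) ->
  lebesgue_Rn n [set x | forall i, A i (tnth x i)] =
  (\prod_(i < n) lebesgue_measure (A i))%E.
Proof.
elim: n A => [|n IH] A mA.
  rewrite big_ord0 /= diracE mem_set//= => -[]//.
rewrite big_ord_recl -IH// -product_measure1E//.
  congr (product_measure1 _ _ _); apply/seteqP; split => -[a t] /=.
    move=> At; split; first exact: (At ord0).
    by move=> i; have := At (lift ord0 i); rewrite tnthS.
  move=> [Aa At] i; have [j ->|->//] := unliftP ord0 i.
  by rewrite tnthS; exact: At.
  exact: mA.
rewrite [X in measurable X](_ : _ = \bigcap_(i : 'I_n)
    ((fun t : n.-tuple R => tnth t i) @^-1` A (lift ord0 i))).
  apply: fin_bigcap_measurable => // i _.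
  by rewrite -[X in measurable X]setTI; exact: measurable_tnth.
by apply/seteqP; split => x xA i; [move=> _; exact: xA|exact: xA].
Qed.

End lebesgue_measure_Rn.

Section dyadic_analysis.
Context {R : realType} {n : nat}.

Local Notation Rn := (n.-tuple R).
Local Notation mu := (lebesgue_Rn n).

(* (c, k) encodes the half-open cube \prod_i [c_i, c_i + 2^k[. *)
Definition cube : Type := (Rn * int)%type.

Implicit Types (Q P : cube) (D S : set cube) (f g a b : Rn -> R).
Implicit Types (x : Rn) (e : {ffun 'I_n -> bool}).

Definition side Q : R := 2 ^ Q.2.

Definition points Q : set Rn :=
  [set x | forall i, tnth x i \in `[tnth Q.1 i, tnth Q.1 i + side Q[].

Definition vol Q : R := fine (mu (points Q)).

Definition dyadic_grid D : Prop :=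
  (forall k : int,
     classical_sets.partition [set Q | D Q /\ Q.2 = k] points setT) /\
  (forall P Q, D P -> D Q ->
     [\/ points P `&` points Q = points P,
         points P `&` points Q = points Q |
         points P `&` points Q = set0]).

Definition carleson D S (L : R) : Prop := forall Q, D Q ->
  (\esum_(P in [set P | S P /\ points P `<=` points Q]) (vol P)%:E
     <= (L * vol Q)%:E)%E.

Definition has_increasing_chain S : Prop :=
  exists Q : nat -> cube,
    forall k, S (Q k) /\ points (Q k) `<` points (Q k.+1).

(* The sum of an absolutely convergent family of reals; the value is only
   meaningful when [summable I (EFin \o u)] holds. *)
Definition rsum (T : choiceType) (I : set T) (u : T -> R) : R :=
  fine (\esum_(i in I) ((EFin \o u)^\+ i) - \esum_(i in I) ((EFin \o u)^\- i))%E.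

(* Measurability in the sense of Lebesgue; the sigma-algebra on tuples is only
   the Borel one. *)
Definition Lmeasurable f : Prop :=
  exists2 g, measurable_fun setT g & {ae mu, forall x, f x = g x}.

(* Compactness is that of 'rV[R]_n. *)
Definition loc_integrable f : Prop := Lmeasurable f /\
  forall K : set 'rV[R]_n, compact K ->
    (\int[mu]_(x in [set x | K (\row_i tnth x i)]) `|f x|%:E < +oo)%E.

Definition avg f Q : R := (vol Q)^-1 * \int[mu]_(x in points Q) f x.

Definition inner f g : R := \int[mu]_x (f x * g x).

(* h_I^0 (for ep = false) and h_I^1 (for ep = true), where I = [c, c + l[. *)
Definition haar1 (c l : R) (ep : bool) : R -> R := fun t =>
  (Num.sqrt l)^-1 *
  (if ep then \1_(`[c, c + l[%classic) t
   else \1_(`[c + l / 2, c + l[%classic) t - \1_(`[c, c + l / 2[%classic) t).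

Definition haar Q e : Rn -> R := fun x =>
  \prod_(i < n) haar1 (tnth Q.1 i) (side Q) (e i) (tnth x i).

Definition cancellative e : bool := e != [ffun=> true].

Definition bmo_norm D b : \bar R :=
  ereal_sup [set ((vol Q)^-1%:E *
    \int[mu]_(x in points Q) `|b x - avg b Q|%:E)%E | Q in D].

Definition bmo D : set (Rn -> R) :=
  [set b | loc_integrable b /\ (bmo_norm D b < +oo)%E].

(* Each series over cubes is given by its general term at x, so that its
   convergence at x can be stated as well. *)
Definition btilde_term x Q : R :=
  \sum_(e | cancellative e) Num.sqrt (vol Q) * haar Q e x.

Definition btilde S : Rn -> R := fun x => rsum S (btilde_term x).

Definition sparse_term f x Q : R := avg f Q * \1_(points Q) x.

Definition sparse_op S f : Rn -> R := fun x => rsum S (sparse_term f x).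

Definition paraprod2_term a b f x Q : R :=
  \sum_(e | cancellative e)
    inner a (haar Q e) * inner b (haar Q e) * avg f Q *
    (\1_(points Q) x / vol Q).

(* Pi_a^* Pi_b f *)
Definition paraprod2 D a b f : Rn -> R := fun x =>
  rsum D (paraprod2_term a b f x).

End dyadic_analysis.

Arguments cube : clear implicits.

(* Main.v *)
Require Import Defs.
From mathcomp Require Import all_boot all_order all_algebra.
From mathcomp Require Import all_classical all_reals all_analysis.
From mathcomp Require Import measurable_realfun finmap lra ring zify.
Import Order.TTheory GRing.Theory Num.Theory.
Import numFieldNormedType.Exports.

Set Implicit Arguments.
Unset Strict Implicit.
Unset Printing Implicit Defensive.

Local Open Scope classical_set_scope.
Local Open Scope ring_scope.

(** The signs of the cancellative Haar functions of a cube [Q] add up, on each of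
the [2 ^ n] halves of [Q], to [2 ^ n - 1] on the half where all of them are
positive and to [-1] on the others ([sum_cancellative]). Hence
[btilde S] is the sum over the cubes [Q] of [S] of simple functions, called jumps
here, which are supported in [Q], constant on the halves of [Q], bounded by
[2 ^ n], and of mean zero.

A cube of the grid strictly inside [Q] lies in a single half of [Q]
([grid_in_child]; this has to be extracted from the grid axioms), so that
anything constant on the halves of [Q] is constant on it. Therefore the jumps of
different cubes are orthogonal, and the jump of a smaller cube is orthogonal to
every Haar function of [Q] ([jump_step_orthogonal]).

Fix [Q] in the grid. Without an infinite increasing chain, only finitely many
cubes of [S] strictly contain [Q], and on [Q] their jumps add up to a constant.
By the Carleson condition the jumps of the cubes inside [Q] form an absolutely
convergent series in [L^1]. So on [Q], up to an arbitrarily small [L^1] error,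
[btilde S] is a constant plus a finite sum of orthogonal jumps inside [Q]
([btilde_approx]). Two facts follow.
- The oscillation of [btilde S] over [Q] is at most the [L^1] mean of such a sum,
  hence at most its [L^2] mean, whose square is [2 ^ n - 1] times the total
  volume of the cubes involved divided by [vol Q]; the Carleson condition bounds
  this by [(2 ^ n - 1) * Lambda] ([Rintegral_oscillation]).
- The coefficient of [btilde S] on a cancellative Haar function of [Q] comes from
  the jump of [Q] alone: it is [sqrt (vol Q)] when [Q] belongs to [S] and [0]
  otherwise ([inner_btilde_haar]).

The coefficients turn the general term of the composed paraproduct into
[2 ^ n - 1] times that of the sparse operator for cubes of [S], and into [0] for
the others. Almost every point lies in finitely many cubes of [S]
([ae_finite]), and at such a point all the series of the theorem are finite
sums. *)

(** * Sums over countable sets *)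

(** The same enumeration has to serve every summand: for a family of functions it
must not depend on the point. *)
Lemma esum_series (R : realType) (T : choiceType) (I : set T) :
  countable I -> I !=set0 ->
  exists (e : nat -> T) (J : set nat), (forall j, J j -> I (e j)) /\
    forall a : T -> \bar R, (forall i, I i -> 0 <= a i)%E ->
      (\esum_(i in I) a i = \sum_(j <oo) if j \in J then a (e j) else 0)%E.
Proof.
move=> /countable_injP[c cinj] [i0 Ii0].
pose J := c @` I.
have /choice[e eP] (j : nat) : exists i, I i /\ (J j -> c i = j).
  by have [[i Ii <-]|nJ] := pselect (J j); [exists i | exists i0; split].
exists e, J; split => [j _|a a0]; first by have [] := eP j.
have eK i : I i -> e (c i) = i.
  move=> Ii; have [Ie ce] := eP (c i).
  by apply: cinj; [exact: mem_set|exact: mem_set|apply: ce; exists i].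
have IE : I = e @` J.
  apply/seteqP; split => [i Ii|_ [j _ <-]]; last by have [] := eP j.
  by exists (c i); [exists i|exact: eK].
have einj : set_inj J e.
  by move=> j k /set_mem[i Ii <-] /set_mem[l Il <-]; rewrite !eK// => ->.
rewrite [in LHS]IE esum_image// esum_mkcond nneseries_esumT// => j.
by case: ifP => // _; apply: a0; have [] := eP j.
Qed.

(** An enumeration of the index set reduces the next statements to the results
on series of functions indexed by the natural numbers. *)
Section countable_sums.
Context d (T : measurableType d) (R : realType).
Variables (mu : {measure set T -> \bar R}) (X : choiceType) (I : set X).
Hypothesis cI : countable I.
Local Open Scope ereal_scope.

Lemma measurable_fun_esum (D : set T) (f : X -> T -> \bar R) :
  (forall i, I i -> measurable_fun D (f i)) ->
  (forall i x, I i -> 0 <= f i x) ->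
  measurable_fun D (fun x => \esum_(i in I) f i x).
Proof.
move=> mf f0; have [->|/set0P IN0] := eqVneq I set0.
  by under eq_fun do rewrite esum_set0; exact: measurable_cst.
have [e [J [eI esumE]]] := esum_series R cI IN0.
under eq_fun => x do rewrite (esumE (f ^~ x) (fun i => f0 i x)).
apply: (@ge0_emeasurable_sum _ _ _ _
  (fun j x => if j \in J then f (e j) x else 0) xpredT) => [j x _ _|j _].
  by case: (boolP (j \in J)) => // /set_mem /eI; exact: f0.
case: (boolP (j \in J)) => [/set_mem /eI|_]; first exact: mf.
exact: measurable_cst.
Qed.

Lemma ge0_integral_esum (D : set T) (f : X -> T -> \bar R) :
  measurable D ->
  (forall i, I i -> measurable_fun D (f i)) ->
  (forall i x, I i -> 0 <= f i x) ->
  \int[mu]_(x in D) (\esum_(i in I) f i x) =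
  \esum_(i in I) \int[mu]_(x in D) f i x.
Proof.
move=> mD mf f0; have [->|/set0P IN0] := eqVneq I set0.
  by under eq_integral do rewrite esum_set0; rewrite integral0 esum_set0.
have [e [J [eI esumE]]] := esum_series R cI IN0.
under eq_integral => x _ do rewrite (esumE (f ^~ x) (fun i => f0 i x)).
rewrite integral_nneseries//.
- rewrite esumE; last by move=> i Ii; apply: integral_ge0 => x _; exact: f0.
  by apply: eq_eseriesr => j _; case: ifPn => // _; rewrite integral0.
- move=> j; case: (boolP (j \in J)) => [/set_mem /eI|_]; first exact: mf.
  exact: measurable_cst.
- by move=> j x _; case: ifPn => // /set_mem /eI; exact: f0.
Qed.

(** [rsum] is a measurable expression in two sums of nonnegative functions, also at
the points where these are infinite and [fine] returns its default value. *)
Lemma measurable_fun_rsum (u : X -> T -> R) :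
  (forall i, I i -> measurable_fun setT (u i)) ->
  measurable_fun setT (fun x => rsum I (u ^~ x)).
Proof.
move=> mu_; apply: (measurableT_comp (@fine_measurable R setT measurableT)) => //.
apply: emeasurable_funB.
- rewrite (_ : (fun _ => _) = fun x => \esum_(i in I) (EFin \o u i)^\+ x).
    apply: measurable_fun_esum => // i Ii.
    by apply: measurable_funepos; apply/measurable_EFinP; exact: mu_.
  by apply/funext => x; apply: eq_esum => i _; rewrite !funeposE.
- rewrite (_ : (fun _ => _) = fun x => \esum_(i in I) (EFin \o u i)^\- x).
    apply: measurable_fun_esum => // i Ii.
    by apply: measurable_funeneg; apply/measurable_EFinP; exact: mu_.
  by apply/funext => x; apply: eq_esum => i _; rewrite !funenegE.
Qed.

End countable_sums.

Section rsum_theory.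
Context {R : realType} {T : choiceType}.
Implicit Types (I F : set T) (u : T -> R).

Let pos u i : \bar R := ((EFin \o u)^\+ i)%E.
Let neg u i : \bar R := ((EFin \o u)^\- i)%E.

Let pos_ge0 u i : (0 <= pos u i)%E. Proof. exact: funepos_ge0. Qed.
Let neg_ge0 u i : (0 <= neg u i)%E. Proof. exact: funeneg_ge0. Qed.

Lemma rsumE I u : summable I (EFin \o u) ->
  (rsum I u)%:E = (\esum_(i in I) pos u i - \esum_(i in I) neg u i)%E.
Proof.
move=> Iu; rewrite fineK// fin_numB; apply/andP; split.
- have := summable_funepos Iu; rewrite summableE; congr (_ \is a fin_num).
  by apply: eq_esum => i _; rewrite gee0_abs.
- have := summable_funeneg Iu; rewrite summableE; congr (_ \is a fin_num).
  by apply: eq_esum => i _; rewrite gee0_abs.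
Qed.

Lemma le_abs_rsum I u :
  (`|rsum I u|%:E <= \esum_(i in I) `|u i|%:E)%E.
Proof.
have [/eqP->|] := boolP (\esum_(i in I) `|u i|%:E == +oo)%E; first exact: leey.
rewrite -ltey => Iu.
rewrite -abse_EFin rsumE//; apply: (le_trans (lee_abs_sub _ _)).
rewrite !gee0_abs ?esum_ge0// -esumD//; apply: le_esum => i _.
by rewrite -[leRHS]/((abse \o (EFin \o u)) i) fune_abse.
Qed.

Lemma esum_finite_setD F I (a : T -> \bar R) : finite_set F -> F `<=` I ->
  (forall i, 0 <= a i)%E ->
  (\esum_(i in I) a i = \sum_(i \in F) a i + \esum_(i in I `\` F) a i)%E.
Proof.
move=> finF FI a0; rewrite (esumID F)//; congr (_ + _)%E.
rewrite (_ : I `&` F = F); last by apply/setIidPr.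
by rewrite esum_fset.
Qed.

(** This holds for every family: if [u] is not summable over [I], then it is not
summable outside the finite set [F] either, and the right-hand side is
infinite. It thus gives a pointwise bound valid at all points, without
exceptional null sets. *)
Lemma rsum_approx F I u : finite_set F -> F `<=` I ->
  (`|rsum I u - \sum_(i \in F) u i|%:E <= \esum_(i in I `\` F) `|u i|%:E)%E.
Proof.
move=> finF FI.
have [/eqP->|] := boolP (\esum_(i in I `\` F) `|u i|%:E == +oo)%E.
  exact: leey.
rewrite -ltey -/(summable (I `\` F) (EFin \o u)) => Ju.
have finsum (f : T -> \bar R) : (forall i, f i \is a fin_num) ->
    (\sum_(i \in F) f i)%E \is a fin_num.
  by move=> ff; rewrite fsbig_finite//; apply/sum_fin_numP.
have Iu : summable I (EFin \o u).
  rewrite /summable (esum_finite_setD finF FI)//.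
  by rewrite lte_add_pinfty// ltey_eq finsum.
suff -> : rsum I u - \sum_(i \in F) u i = rsum (I `\` F) u.
  exact: le_abs_rsum.
pose p i := Num.max (u i) 0; pose q i := Num.max (- u i) 0.
have pE i : pos u i = (p i)%:E by rewrite /pos funeposE -EFin_max.
have qE i : neg u i = (q i)%:E by rewrite /neg funenegE -EFin_max.
have -> : \sum_(i \in F) u i = \sum_(i \in F) p i - \sum_(i \in F) q i.
  rewrite !fsbig_finite// -sumrB; apply: eq_bigr => i _.
  by rewrite /p /q; case: leP => ?; case: leP => ?; lra.
apply/EFin_inj; rewrite !EFinB !rsumE// !(esum_finite_setD finF FI)//.
have -> : (\sum_(i \in F) pos u i)%E = (\sum_(i \in F) p i)%:E.
  by rewrite -fsumEFin//; apply: eq_fsbigr => i _; exact: pE.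
have -> : (\sum_(i \in F) neg u i)%E = (\sum_(i \in F) q i)%:E.
  by rewrite -fsumEFin//; apply: eq_fsbigr => i _; exact: qE.
have := summable_funepos Ju; have := summable_funeneg Ju.
rewrite !summableE.
have -> : (\esum_(i in I `\` F) `|(EFin \o u)^\+ i| =
           \esum_(i in I `\` F) pos u i)%E.
  by apply: eq_esum => i _; rewrite gee0_abs.
have -> : (\esum_(i in I `\` F) `|(EFin \o u)^\- i| =
           \esum_(i in I `\` F) neg u i)%E.
  by apply: eq_esum => i _; rewrite gee0_abs.
case: (esum _ _) => // y _; case: (esum _ _) => // x _.
by rewrite -?EFinD; congr EFin; ring.
Qed.
End rsum_theory.

Section esum_theory.
Context {R : realType} {T : choiceType}.
Implicit Types (I F : set T) (u : T -> R).
Local Open Scope ereal_scope.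

Lemma esum_tail F I (a : T -> \bar R) (e : R) : finite_set F -> F `<=` I ->
  (forall i, 0 <= a i) -> (forall i, a i < +oo) ->
  \esum_(i in I) a i < +oo -> (0 < e)%R ->
  exists G, [/\ finite_set G, F `<=` G, G `<=` I &
    \esum_(i in I `\` G) a i <= e%:E].
Proof.
move=> finF FI a0 aoo sumoo e0.
have sumfin : \esum_(i in I) a i \is a fin_num.
  by rewrite ge0_fin_numE// esum_ge0.
have [_ [X [finX XI] <-] ltX] := ub_ereal_sup_adherent e0 sumfin.
pose G := X `|` F.
have finG : finite_set G by rewrite finite_setU.
have GI : G `<=` I by rewrite subUset.
exists G; split => //; first exact: subsetUr.
have XG : \sum_(i \in X) a i <= \sum_(i \in G) a i.
  apply: lee_fsum_nneg_subset => [//|//|i|i _]; last exact: a0.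
  by move=> /set_mem Xi; apply/mem_set; left.
have Gfin : \sum_(i \in G) a i \is a fin_num.
  by rewrite fsbig_finite//; apply/sum_fin_numP => i _ _; rewrite ge0_fin_numE.
have := lt_le_trans ltX XG; rewrite -/(esum I a) (esum_finite_setD finG GI a0).
move: Gfin; case: (\sum_(i \in G) a i) => // g _.
case: (esum _ _) => [t| |] //; last by rewrite leNye.
by rewrite -!EFinD lte_fin lee_fin => ?; lra.
Qed.

Lemma le_esumZ I (a : T -> \bar R) (c : R) : (forall i, 0 <= a i) ->
  (0 <= c)%R -> \esum_(i in I) (c%:E * a i) <= c%:E * \esum_(i in I) a i.
Proof.
move=> a0 c0; apply: ge_ereal_sup => _ [X [finX XI] <-].
rewrite -ge0_mule_fsumr// lee_wpmul2l ?lee_fin//.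
by apply: ereal_sup_ubound; exists X.
Qed.

Lemma summable_finite F I u : finite_set F -> F `<=` I ->
  (forall i, I i -> ~ F i -> u i = 0%R) -> summable I (EFin \o u).
Proof.
move=> finF FI u0; rewrite /summable (esum_finite_setD finF FI)//.
rewrite esum1 ?adde0; last by move=> i [Ii Fi]; rewrite /= u0// normr0.
by rewrite fsbig_finite// ltey_eq; apply/orP; left; apply/sum_fin_numP.
Qed.

Lemma rsum_finite F I u : finite_set F -> F `<=` I ->
  (forall i, I i -> ~ F i -> u i = 0%R) -> rsum I u = (\sum_(i \in F) u i)%R.
Proof.
move=> finF FI u0; apply/eqP; rewrite -subr_eq0 -normr_le0 -lee_fin.
rewrite (le_trans (rsum_approx u finF FI))// esum1//.
by move=> i [Ii Fi]; rewrite u0// normr0.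
Qed.

End esum_theory.

(** The integral of a nonnegative function, measurable or not, is a supremum over
the simple functions below it, and there are more of these below [g]. *)
Lemma ge0_le_integralT d (T : measurableType d) (R : realType)
    (mu : {measure set T -> \bar R}) (f g : T -> \bar R) :
  (forall x, 0 <= f x)%E -> (forall x, f x <= g x)%E ->
  (\int[mu]_x f x <= \int[mu]_x g x)%E.
Proof.
move=> f0 fg; rewrite !ge0_integralTE//; last first.
  by move=> x; exact: le_trans (f0 x) (fg x).
apply: le_ereal_sup; apply: image_subset => h hf x.
exact: le_trans (hf x) (fg x).
Qed.

(** A sum of infinitely many ones diverges. *)
Lemma finite_esum_indic (R : realType) (T U : choiceType)
    (I : set T) (A : T -> set U) (x : U) :
  (\esum_(i in I) (\1_(A i) x : R)%:E < +oo)%E ->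
  finite_set [set i | I i /\ A i x].
Proof.
move=> sumoo; apply: contrapT => inf.
set s := esum I _ in sumoo.
have sfin : s \is a fin_num.
  by rewrite ge0_fin_numE// esum_ge0// => i _; rewrite lee_fin.
have [B BI] := infinite_set_fset (Num.truncn (fine s)).+1 inf.
rewrite -(ler_nat R) => truncB; have := truncnS_gt (fine s).
apply/negP; rewrite -leNgt (le_trans truncB)// -lee_fin fineK//.
apply: esum_ge; exists [set` B].
  by split; [exact: finite_fset|move=> i /BI[]].
rewrite fsbig_finite ?set_fsetK//=.
rewrite big_seq (eq_bigr (fun=> 1%E)) => [|i /BI[_ Ai]]; last first.
  by rewrite indicE mem_set.
by rewrite -big_seq sumEFin big_const_seq count_predT iter_addr_0 lee_fin.
Qed.

(** * Dyadic grids *)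

Local Ltac ilra := intros; lra.

Lemma inj_finite_set (T U : Type) (A : set T) (B : set U) (f : T -> U) :
  f @` A `<=` B -> set_inj A f -> finite_set B -> finite_set A.
Proof.
move=> fAB finj finB; rewrite -(eq_finite_set (inj_card_eq finj)).
exact: sub_finite_set fAB finB.
Qed.

Section cubes.
Context {R : realType} {n : nat}.
Implicit Types (P Q : cube R n) (x : n.-tuple R) (s : {ffun 'I_n -> bool}).
Local Notation mu := (lebesgue_Rn n).

Lemma pointsP Q x : points Q x <->
  forall i, tnth Q.1 i <= tnth x i < tnth Q.1 i + side Q.
Proof. by split => Qx i; have := Qx i; rewrite /= in_itv. Qed.

Lemma side_gt0 Q : 0 < side Q.
Proof. by rewrite exprz_gt0. Qed.
#[local] Hint Resolve side_gt0 : core.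

Lemma le_side P Q : (side P <= side Q) = (P.2 <= Q.2).
Proof. by rewrite /side ler_eXz2l// ltr1n. Qed.

Lemma corner_in Q : points Q Q.1.
Proof. by apply/pointsP => i; rewrite lexx ltrDl side_gt0. Qed.

Lemma measurable_points Q : measurable (points Q).
Proof.
rewrite (_ : points Q = \bigcap_(i : 'I_n) ((fun t : n.-tuple R => tnth t i)
    @^-1` `[tnth Q.1 i, tnth Q.1 i + side Q[)).
  apply: fin_bigcap_measurable => // i _.
  by rewrite -[X in measurable X]setTI; exact: measurable_tnth.
by apply/seteqP; split => x xQ i; [move=> _; exact: xQ|exact: xQ].
Qed.

Lemma mu_points Q : mu (points Q) = (side Q ^+ n)%:E.
Proof.
rewrite (lebesgue_Rn_box
  (A := fun i => `[tnth Q.1 i, tnth Q.1 i + side Q[%classic))//.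
rewrite (eq_bigr (fun=> (side Q)%:E)); last first.
  move=> i _; rewrite lebesgue_measure_itv /= lte_fin ltrDl side_gt0.
  by rewrite -EFinB addrC addKr.
by rewrite prodEFin prodr_const card_ord.
Qed.

Lemma volE Q : vol Q = side Q ^+ n.
Proof. by rewrite /vol mu_points. Qed.

Lemma vol_gt0 Q : 0 < vol Q.
Proof. by rewrite volE exprn_gt0. Qed.

Lemma mu_vol Q : mu (points Q) = (vol Q)%:E.
Proof. by rewrite mu_points volE. Qed.

Definition child Q s : cube R n :=
  ([tuple tnth Q.1 i + (if s i then side Q / 2 else 0) | i < n], Q.2 - 1).

Lemma side_child Q s : side (child Q s) = side Q / 2.
Proof. by rewrite /side /= expfzDr ?pnatr_eq0. Qed.

Lemma vol_child Q s : vol (child Q s) = vol Q / 2 ^+ n.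
Proof. by rewrite !volE side_child expr_div_n. Qed.

Definition half_of Q x : {ffun 'I_n -> bool} :=
  [ffun i => tnth Q.1 i + side Q / 2 <= tnth x i].

Lemma points_childP Q s x :
  points (child Q s) x <-> points Q x /\ half_of Q x = s.
Proof.
have Q0 := side_gt0 Q.
split=> [/pointsP Cx|[/pointsP Qx <-]]; last first.
  apply/pointsP => i; rewrite side_child tnth_mktuple ffunE.
  by case: (leP (tnth Q.1 i + side Q / 2)); have := Qx i; ilra.
split; [apply/pointsP => i|apply/ffunP => i; rewrite ffunE];
  have := Cx i; rewrite side_child tnth_mktuple.
- by case: (s i); ilra.
- by case: (leP (tnth Q.1 i + side Q / 2)); case: (s i) => //; ilra.
Qed.

Lemma sub_child Q s : points (child Q s) `<=` points Q.
Proof. by move=> x /points_childP[]. Qed.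

Section positive_dimension.
Hypothesis hn : (0 < n)%N.

Lemma sub_side P Q : points P `<=` points Q -> side P <= side Q.
Proof.
move=> PQ; rewrite leNgt; apply/negP => QP; pose o := Ordinal hn.
have /pointsP/(_ o) cQ := PQ _ (corner_in P).
have /PQ/pointsP/(_ o) : points P [tuple tnth P.1 i + side Q | i < n].
  apply/pointsP => i; rewrite tnth_mktuple; have := side_gt0 Q; ilra.
by rewrite tnth_mktuple; ilra.
Qed.

Section grid.
Variable D : set (cube R n).
Hypothesis hD : dyadic_grid D.

Lemma grid_cover (k : int) x : exists Q, [/\ D Q, Q.2 = k & points Q x].
Proof.
have [[+ _ _] _] := (hD.1 k, tt); rewrite /cover => /seteqP[_ /(_ x I)].
by move=> [Q [DQ Qk] Qx]; exists Q.
Qed.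

Lemma grid_eq P Q x : D P -> D Q -> P.2 = Q.2 -> points P x -> points Q x ->
  P = Q.
Proof.
move=> DP DQ PQ Px Qx; have [_ tD _] := hD.1 Q.2.
by apply: tD => //; exists x.
Qed.

(** If the nesting axiom puts [Q] inside [P], then comparing sides shows that the
two cubes have the same generation, so that they are equal. *)
Lemma grid_sub P Q x : D P -> D Q -> P.2 <= Q.2 -> points P x -> points Q x ->
  points P `<=` points Q.
Proof.
move=> DP DQ PQ Px Qx; have [/setIidPl//|/setIidPr QP|PQ0] := hD.2 _ _ DP DQ.
  have /eqP PQ2 : P.2 == Q.2 by rewrite eq_le PQ -le_side sub_side.
  by rewrite (grid_eq DP DQ PQ2 Px Qx).
by have : (points P `&` points Q) x by []; rewrite PQ0.
Qed.

Lemma grid_lt P Q : D P -> D Q -> points P `<=` points Q -> P != Q ->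
  P.2 < Q.2.
Proof.
move=> DP DQ PQ; rewrite ltNge; apply: contra_neqN => QP.
apply: (grid_eq DP DQ _ (corner_in P) (PQ _ (corner_in P))).
by apply/eqP; rewrite eq_le QP andbT -le_side sub_side.
Qed.

Let upd x i t : n.-tuple R := [tuple if j == i then t else tnth x j | j < n].

(** The grid axioms force the cubes of the next finer generation inside [Q] to
be the halves of [Q]: if a corner coordinate of [P] were strictly between the
two allowed values, the cube of the same generation just beyond the upper face
of [P] would stay inside [Q], hence would have to overlap [P]. *)
Lemma grid_child P Q : D P -> D Q -> P.2 = Q.2 - 1 ->
  points P `<=` points Q -> exists s, P = child Q s.
Proof.
move=> DP DQ lev PQ.
have sideQ : side Q = side P * 2.
  by rewrite /side lev expfzDr ?pnatr_eq0// -mulrA mulVf ?mulr1 ?pnatr_eq0.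
have P0 := side_gt0 P.
have /pointsP cQ := PQ _ (corner_in P).
have corner i : tnth P.1 i = tnth Q.1 i \/ tnth P.1 i = tnth Q.1 i + side P.
  have Pi : tnth P.1 i <= tnth Q.1 i + side P.
    rewrite leNgt; apply/negP => gtP.
    have /PQ/pointsP/(_ i) : points P (upd P.1 i (tnth Q.1 i + side Q)).
      apply/pointsP => j; rewrite tnth_mktuple; have := cQ i.
      by case: eqP => [->|_]; ilra.
    by rewrite tnth_mktuple eqxx ltxx andbF.
  apply: contrapT => /not_orP[/eqP P1 /eqP P2].
  have {}P1 : tnth Q.1 i < tnth P.1 i.
    by rewrite lt_neqAle eq_sym P1; case/andP: (cQ i).
  have {}P2 : tnth P.1 i < tnth Q.1 i + side P by rewrite lt_neqAle P2.
  (* The cube just beyond the face of [P] orthogonal to the axis [i]. *)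
  have [P' [DP' P'lev P'x]] := grid_cover P.2 (upd P.1 i (tnth P.1 i + side P)).
  have sP' : side P' = side P by rewrite /side P'lev.
  have Qx : points Q (upd P.1 i (tnth P.1 i + side P)).
    apply/pointsP => j; rewrite tnth_mktuple; have := cQ j.
    by case: eqP => [->|_]; ilra.
  have P'Q : points P' `<=` points Q.
    by apply: grid_sub P'x Qx => //; rewrite P'lev lev gerBl.
  have P'i : tnth P'.1 i <= tnth Q.1 i + side P.
    rewrite leNgt; apply/negP => gtP.
    have /pointsP cQ' := P'Q _ (corner_in P').
    have /P'Q/pointsP/(_ i) : points P' (upd P'.1 i (tnth Q.1 i + side Q)).
      apply/pointsP => j; rewrite tnth_mktuple; have := cQ' i.
      by case: eqP => [->|_]; ilra.
    by rewrite tnth_mktuple eqxx ltxx andbF.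
  have /pointsP P'x' := P'x.
  have P'Pi : tnth P.1 i < tnth P'.1 i.
    by have := P'x' i; rewrite tnth_mktuple eqxx; ilra.
  suff PP' : P = P' by move: P'Pi; rewrite PP' ltxx.
  apply: (@grid_eq _ _ (upd P.1 i (tnth P'.1 i))) => //.
    apply/pointsP => j; rewrite tnth_mktuple.
    by case: eqP => [->|_]; ilra.
  apply/pointsP => j; rewrite tnth_mktuple; have := P'x' j; rewrite tnth_mktuple.
  by case: eqP => [->|_]; ilra.
exists [ffun i => tnth P.1 i != tnth Q.1 i].
rewrite [LHS]surjective_pairing; congr pair => //.
apply: eq_from_tnth => i; rewrite tnth_mktuple ffunE.
have [->|->] := corner i; first by rewrite eqxx addr0.
by rewrite gt_eqF ?ltrDl// sideQ mulfK ?pnatr_eq0.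
Qed.

Lemma grid_in_child P Q : D P -> D Q -> points P `<=` points Q -> P != Q ->
  exists s, points P `<=` points (child Q s).
Proof.
move=> DP DQ PQ nPQ; have lt := grid_lt DP DQ PQ nPQ.
have [C [DC Clev Cx]] := grid_cover (Q.2 - 1) P.1.
have /(grid_child DC DQ Clev)[s CE] : points C `<=` points Q.
  by apply: grid_sub Cx (PQ _ (corner_in P)) => //; rewrite Clev gerBl.
exists s; rewrite -CE; apply: grid_sub (corner_in P) Cx => //.
by rewrite Clev; lia.
Qed.

(** A point common to two cubes of one generation is the coordinatewise maximum
of their corners; it exists as soon as the corners lie in the same cell of the
lattice of that mesh. *)
Lemma grid_floor_inj P Q : D P -> D Q -> P.2 = Q.2 ->
  (forall i, Num.floor (tnth P.1 i / side P) =
             Num.floor (tnth Q.1 i / side Q)) ->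
  P = Q.
Proof.
move=> DP DQ lev eqf; have sPQ : side P = side Q by rewrite /side lev.
have near i : `|tnth P.1 i - tnth Q.1 i| < side Q.
  have := eqf i; rewrite sPQ => fi.
  have := floor_itv (tnth P.1 i / side Q); rewrite fi.
  have := floor_itv (tnth Q.1 i / side Q).
  rewrite !intrD !ler_pdivlMr// !ltr_pdivrMr// !mulrDl mul1r.
  by rewrite ltr_norml; ilra.
pose m : n.-tuple R := [tuple Num.max (tnth P.1 i) (tnth Q.1 i) | i < n].
apply: (@grid_eq _ _ m) => //; apply/pointsP => i; rewrite tnth_mktuple.
- have := near i; have := side_gt0 Q; rewrite sPQ ltr_norml.
  by case: (leP (tnth P.1 i) (tnth Q.1 i)); ilra.
- have := near i; have := side_gt0 Q; rewrite ltr_norml.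
  by case: (leP (tnth P.1 i) (tnth Q.1 i)); ilra.
Qed.

(** By [grid_floor_inj] a cube is determined by its generation and the cell of its
corner. *)
Lemma grid_countable : countable D.
Proof.
apply/countable_injP.
exists (fun Q => choice.pickle
  ([tuple Num.floor (tnth Q.1 i / side Q) | i < n], Q.2)).
move=> P Q /set_mem DP /set_mem DQ /(pcan_inj choice.pickleK) H.
have E := congr1 fst H; have lev := congr1 snd H.
apply: grid_floor_inj => // i.
have := congr1 (fun t => tnth t i) E.
by rewrite !tnth_mktuple.
Qed.

(** A unit cube that meets the box of radius [N] has its corner in one of the
cells numbered from [- N - 1] to [N]; the shift by [N + 1] makes these numbers
nonnegative and smaller than [2 N + 2]. *)
Lemma grid_finite_meet (N : nat) : finite_set [set Q | [/\ D Q, Q.2 = 0 &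
  exists2 x, points Q x & forall i, `|tnth x i| <= N%:R]].
Proof.
pose f Q : {ffun 'I_n -> 'I_(N + N).+2} :=
  [ffun i => inord (absz (Num.floor (tnth Q.1 i / side Q) + N%:Z + 1))].
apply: (@inj_finite_set _ _ _ setT f) => [//| |]; last first.
  exact: (@finite_finset {ffun 'I_n -> 'I_(N + N).+2}).
have bnd Q : Q.2 = 0 ->
    (exists2 x, points Q x & forall i, `|tnth x i| <= N%:R) ->
    forall i, (- N%:Z - 1 <= Num.floor (tnth Q.1 i / side Q) <= N%:Z).
  move=> lev [x /pointsP Qx xN] i.
  have := Qx i; have := xN i; rewrite /side lev expr0z divr1 ler_norml => xi Qi.
  apply/andP; split.
    by rewrite floor_ge_int !rmorphB /= rmorphN /=; ilra.
  by rewrite -(ler_int R); have := floor_itv (tnth Q.1 i); ilra.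
move=> P Q /set_mem[DP P0 /(bnd _ P0) bP] /set_mem[DQ Q0 /(bnd _ Q0) bQ] fPQ.
apply: grid_floor_inj => //; first by rewrite P0.
move=> i.
have := congr1 (fun h : {ffun 'I_n -> 'I_(N + N).+2} => nat_of_ord (h i)) fPQ.
rewrite !ffunE /= !inordK; have := bP i; have := bQ i; lia.
Qed.

(** The cubes above [Q] are nested and determined by their generation. If they are
infinitely many, then above each of them there is another one of a larger
generation, and choosing such cubes one after the other gives an infinite
increasing chain. *)
Lemma finite_above (S : set (cube R n)) Q : S `<=` D ->
  ~ has_increasing_chain S -> D Q ->
  finite_set [set P | [/\ S P, points Q `<=` points P & P != Q]].
Proof.
move=> SD nochain DQ; set U := [set P | _]; apply: contrapT => infU.
have Usub P P' : U P -> U P' -> P.2 <= P'.2 -> points P `<=` points P'.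
  move=> [SP QP _] [SP' QP' _] lev.
  by apply: grid_sub (QP _ (corner_in Q)) (QP' _ (corner_in Q)) => //; exact: SD.
have step P : exists P', U P -> U P' /\ P.2 < P'.2.
  apply: contrapT => /forallNP noP.
  have UP : U P by apply: contrapT => nUP; apply: (noP P).
  apply: infU; apply: (@inj_finite_set _ _ _ `I_(absz (P.2 - Q.2)).+1
    (fun P' => absz (P'.2 - Q.2))); last exact: finite_II.
    move=> _ [P' UP' <-] /=.
    have [SP' QP' P'Q] := UP'.
    have ltQ : Q.2 < P'.2 by apply: grid_lt => //; [exact: SD|rewrite eq_sym].
    have : P'.2 <= P.2.
      by rewrite leNgt; apply/negP => lev; apply: (noP P').
    lia.
  move=> A B /set_mem[SA QA AQ] /set_mem[SB QB BQ] AB.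
  have ltA : Q.2 < A.2 by apply: grid_lt => //; [exact: SD|rewrite eq_sym].
  have ltB : Q.2 < B.2 by apply: grid_lt => //; [exact: SD|rewrite eq_sym].
  apply: (grid_eq (x := Q.1)); [exact: SD|exact: SD|lia| |].
    exact/QA/corner_in.
  exact/QB/corner_in.
have [next nextP] := choice step.
have [P0 UP0] : U !=set0 by exact: infinite_setN0.
apply: nochain; exists (fun k => iter k next P0) => k.
have Uk : U (iter k next P0) by elim: k => // k /nextP[].
have [Uk1 lev] := nextP _ Uk; split; first by case: Uk.
rewrite properEneq; split; last exact/Usub/ltW.
apply/eqP => E; move: lev; rewrite ltNge -le_side sub_side// E.
exact: subset_refl.
Qed.

End grid.
End positive_dimension.
End cubes.
#[global] Hint Extern 0 (@measurable _ _ (points _)) =>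
  apply: measurable_points : core.
#[global] Hint Extern 0 (@measurable _ _ setT) => apply: measurableT : core.

(** * Functions constant on the halves of a cube *)

Section finite_sums.
Context d (T : measurableType d) (R : realType) (mu : {measure set T -> \bar R}).
Variables (D : set T) (mD : measurable D) (I : Type) (f : I -> T -> R).
Hypothesis intf : forall i, mu.-integrable D (EFin \o f i).

Lemma integrable_Rsum (r : seq I) :
  mu.-integrable D (EFin \o (fun x => \sum_(i <- r) f i x)).
Proof.
rewrite (_ : EFin \o _ = fun x => (\sum_(i <- r) (EFin \o f i) x)%E).
  by apply: integrable_sum => // i _.
by apply/funext => x /=; rewrite sumEFin.
Qed.

Lemma Rintegral_sum (r : seq I) :
  \int[mu]_(x in D) (\sum_(i <- r) f i x) = \sum_(i <- r) \int[mu]_(x in D) f i x.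
Proof.
rewrite /Rintegral; under eq_integral do rewrite -sumEFin.
rewrite (integral_sum mD intf) -sum_fine// => i _.
exact: integrable_fin_num.
Qed.

End finite_sums.

Section step.
Context {R : realType} {n : nat}.
Implicit Types (P Q : cube R n) (x : n.-tuple R) (s e : {ffun 'I_n -> bool}).
Implicit Types (v w : {ffun 'I_n -> bool} -> R).
Local Notation mu := (lebesgue_Rn n).

Definition step Q v x : R := \1_(points Q) x * v (half_of Q x).

Lemma step_out Q v x : ~ points Q x -> step Q v x = 0.
Proof. by move=> Qx; rewrite /step indicE memNset// mul0r. Qed.

Lemma step_in Q v x : points Q x -> step Q v x = v (half_of Q x).
Proof. by move=> Qx; rewrite /step indicE mem_set// mul1r. Qed.

Lemma stepM Q v w x : step Q v x * step Q w x = step Q (fun s => v s * w s) x.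
Proof.
have [Qx|Qx] := pselect (points Q x); first by rewrite !step_in.
by rewrite !step_out ?mul0r.
Qed.

Lemma step_scale Q v (c : R) x : c * step Q v x = step Q (fun s => c * v s) x.
Proof. by rewrite /step mulrCA. Qed.

(** On [P] the second factor is the constant [w s]. *)
Lemma step_childM P Q s v w x : points P `<=` points (child Q s) ->
  step P v x * step Q w x = w s * step P v x.
Proof.
move=> PQ; have [Px|Px] := pselect (points P x); last first.
  by rewrite (step_out _ Px) mul0r mulr0.
by have /points_childP[Qx <-] := PQ _ Px; rewrite mulrC (step_in _ Qx).
Qed.

Lemma step_disjM P Q v w x : points P `&` points Q = set0 ->
  step P v x * step Q w x = 0.
Proof.
move=> PQ0; have [Px|Px] := pselect (points P x); last first.
  by rewrite (step_out _ Px) mul0r.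
rewrite [X in _ * X]step_out ?mulr0// => Qx.
by have : (points P `&` points Q) x by []; rewrite PQ0.
Qed.

Lemma step_sum Q v x :
  step Q v x = \sum_s v s * \1_(points (child Q s)) x.
Proof.
have [Qx|Qx] := pselect (points Q x); last first.
  rewrite step_out// big1// => s _; rewrite indicE memNset ?mulr0//.
  by move/sub_child.
rewrite step_in// (bigD1 (half_of Q x))//= indicE mem_set; last exact/points_childP.
rewrite mulr1 big1 ?addr0// => s shalf; rewrite indicE memNset ?mulr0//.
by move=> /points_childP[_ E]; rewrite E eqxx in shalf.
Qed.

Lemma integrable_cube (A : set (n.-tuple R)) Q : measurable A ->
  mu.-integrable A (EFin \o \1_(points Q)).
Proof.
move=> mA; apply: (integrableS measurableT) => //; apply/integrableP; split.
  by apply/measurable_EFinP; apply: measurable_indic.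
under eq_integral => x _ do rewrite /= indicE normr_nat -indicE.
by rewrite integral_indic// setIT [ltLHS]mu_vol ltry.
Qed.

Lemma measurable_step Q v : measurable_fun setT (step Q v).
Proof.
rewrite (_ : step Q v = fun x => \sum_s v s * \1_(points (child Q s)) x).
  by apply: measurable_sum => s; apply: measurable_funM => //; apply: measurable_indic.
by apply/funext => x; exact: step_sum.
Qed.

Lemma integrable_step (A : set (n.-tuple R)) Q v : measurable A ->
  mu.-integrable A (EFin \o step Q v).
Proof.
move=> mA.
rewrite (_ : step Q v = fun x => \sum_s v s * \1_(points (child Q s)) x).
  apply: integrable_Rsum => // s.
  exact: integrableZl (integrable_cube _ mA).
by apply/funext => x; exact: step_sum.
Qed.

Lemma Rintegral_step Q v :
  \int[mu]_x step Q v x = vol Q / 2 ^+ n * \sum_s v s.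
Proof.
under eq_Rintegral do rewrite step_sum.
rewrite Rintegral_sum//; last first.
  by move=> s; exact: integrableZl (integrable_cube _ measurableT).
rewrite mulr_sumr; apply: eq_bigr => s _.
rewrite RintegralZl//; last exact: integrable_cube.
rewrite /Rintegral integral_indic// setIT [X in fine X]mu_vol /= vol_child.
by rewrite mulrC.
Qed.

Lemma Rintegral_step_sub (A : set (n.-tuple R)) Q v : points Q `<=` A ->
  \int[mu]_(x in A) step Q v x = \int[mu]_x step Q v x.
Proof.
move=> QA; rewrite Rintegral_mkcond; apply: eq_Rintegral => x _.
rewrite patchE; case: ifPn => // /negP nA; rewrite step_out// => Qx.
by apply: nA; exact/mem_set/QA.
Qed.

(** On each half of its cube the Haar function is a normalizing constant times a
sign, the product of the signs of the half over the coordinates in which the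
function oscillates. *)
Definition haar_sign e s : R := \prod_i (if e i || s i then 1 else -1).

Lemma haar1E (c l : R) (ep : bool) (t : R) : 0 < l ->
  haar1 c l ep t = if c <= t < c + l
    then (Num.sqrt l)^-1 * (if ep || (c + l / 2 <= t) then 1 else -1) else 0.
Proof.
move=> l0; rewrite /haar1 !indicE !mem_setE !in_itv /=.
have [ct|ct] /= := leP c t; last first.
  have /lt_geF -> : t < c + l / 2 by lra.
  by case: ep; rewrite ?subr0 mulr0.
have [tl|tl] /= := ltP t (c + l); last first.
  have /le_gtF -> : c + l / 2 <= t by lra.
  by case: ep; rewrite ?andbF ?subr0 mulr0.
case: ep => //=; rewrite andbT.
by have [h|h] := leP (c + l / 2) t; rewrite ?subr0 ?sub0r.
Qed.

Lemma haar_step Q e x :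
  haar Q e x = step Q (fun s => (Num.sqrt (vol Q))^-1 * haar_sign e s) x.
Proof.
have s0 := side_gt0 Q.
have [Qx|Qx] := pselect (points Q x); last first.
  rewrite step_out//.
  have /existsNP[i /negP/negbTE Qi] : ~ forall i,
      tnth Q.1 i <= tnth x i < tnth Q.1 i + side Q by move/pointsP.
  by rewrite /haar (bigD1 i)//= haar1E// Qi mul0r.
have -> : (Num.sqrt (vol Q))^-1 = (Num.sqrt (side Q))^-1 ^+ n.
  rewrite volE -[in LHS](sqr_sqrtr (ltW s0)) exprAC sqrtr_sqr exprVn.
  by rewrite ger0_norm ?exprn_ge0 ?sqrtr_ge0.
rewrite step_in// /haar_sign.
rewrite -[X in _ ^+ X]card_ord -prodr_const -big_split /=.
by apply: eq_bigr => i _; rewrite haar1E// ffunE (pointsP Q x).1.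
Qed.

(** Sums over all the halves, or over all the Haar functions, of products over the
coordinates factor. *)
Lemma prod_sum_bool (F : 'I_n -> bool -> R) :
  \sum_(s : {ffun 'I_n -> bool}) \prod_i F i (s i) = \prod_i (F i true + F i false).
Proof.
rewrite -(bigA_distr_bigA F); apply: eq_bigr => i _.
by rewrite big_bool.
Qed.

Definition all_up : {ffun 'I_n -> bool} := [ffun=> true].

(** A coordinate in which the function oscillates contributes a factor
[1 - 1 = 0]. *)
Lemma sum_haar_sign e : cancellative e -> \sum_s haar_sign e s = 0.
Proof.
move=> /eqP ec; rewrite (prod_sum_bool (fun i b => if e i || b then 1 else -1)).
have [i ei] : exists i, e i = false.
  apply: contrapT => /forallNP noe; apply: ec; apply/ffunP => i.
  by rewrite ffunE; apply/negP => /negP /negbTE; exact: noe.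
by rewrite (bigD1 i)//= ei orbT subrr mul0r.
Qed.

Lemma haar_sign_all_up e : haar_sign e all_up = 1.
Proof. by rewrite /haar_sign big1// => i _; rewrite ffunE orbT. Qed.

(** The common value on a half of the sum of the signs of all cancellative Haar
functions, as [sum_cancellative] shows. *)
Definition jump s : R := (2 ^+ n *+ (s == all_up)) - 1.

(** Over all Haar functions, cancellative or not, the signs on the half [s] add up
to the product of the factors [1 + 1] or [1 - 1] according to the coordinates of
[s]; the only function that is not cancellative has sign [1]. *)
Lemma sum_cancellative s : \sum_(e | cancellative e) haar_sign e s = jump s.
Proof.
have -> : jump s = \sum_e haar_sign e s - haar_sign all_up s.
  rewrite (prod_sum_bool (fun i b => if b || s i then 1 else -1)) /jump.
  congr (_ - _); last by rewrite /haar_sign big1// => i _; rewrite ffunE.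
  case: eqVneq => [->|snt].
    under eq_bigr do rewrite ffunE /=.
    by rewrite prodr_const card_ord.
  have [i si] : exists i, s i = false.
    apply: contrapT => /forallNP nos; move/eqP: snt; apply; apply/ffunP => i.
    by rewrite ffunE; apply/negP => /negP /negbTE; exact: nos.
  by rewrite (bigD1 i)//= si subrr mul0r.
rewrite [in RHS](bigID cancellative)/= [X in _ + X - _](big_pred1 all_up) ?addrK// => e.
by rewrite /cancellative negbK.
Qed.

Lemma btilde_step Q x : btilde_term x Q = step Q jump x.
Proof.
rewrite /btilde_term; under eq_bigr do rewrite haar_step step_scale.
have q0 : Num.sqrt (vol Q) != 0 by rewrite sqrtr_eq0 -ltNge vol_gt0.
rewrite /step -mulr_sumr -sum_cancellative; congr (_ * _).
by apply: eq_bigr => e _; rewrite mulrA mulfV// mul1r.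
Qed.

Lemma card_halves : #|{: {ffun 'I_n -> bool}}| = (2 ^ n)%N.
Proof. by rewrite card_ffun card_bool card_ord. Qed.

Lemma card_cancellative :
  #|[pred e : {ffun 'I_n -> bool} | cancellative e]|%:R = 2 ^+ n - 1 :> R.
Proof.
have := cardC1 all_up; rewrite card_halves => E.
have -> : #|[pred e : {ffun 'I_n -> bool} | cancellative e]| = (2 ^ n).-1%N.
  by rewrite -E; apply: eq_card.
by rewrite -subn1 natrB ?expn_gt0// natrX.
Qed.

Lemma sum_jumpM (w : {ffun 'I_n -> bool} -> R) :
  \sum_s jump s * w s = 2 ^+ n * w all_up - \sum_s w s.
Proof.
rewrite (eq_bigr (fun s => 2 ^+ n *+ (s == all_up) * w s - w s)); last first.
  by move=> s _; rewrite /jump mulrBl mul1r.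
rewrite big_split /= sumrN; congr (_ - _).
rewrite (bigD1 all_up)//= eqxx mulr1n big1 ?addr0// => s /negbTE ->.
by rewrite mulr0n mul0r.
Qed.

Lemma sum_jump : \sum_s jump s = 0.
Proof.
rewrite (eq_bigr (fun s => jump s * 1)); last by move=> s _; rewrite mulr1.
by rewrite sum_jumpM mulr1 sumr_const card_halves natrX subrr.
Qed.

Lemma sum_jump_sqr : \sum_s jump s * jump s = 2 ^+ n * (2 ^+ n - 1).
Proof. by rewrite sum_jumpM sum_jump subr0 /jump eqxx. Qed.

Lemma sum_jump_haar_sign e : cancellative e ->
  \sum_s jump s * haar_sign e s = 2 ^+ n.
Proof. by move=> ec; rewrite sum_jumpM sum_haar_sign// haar_sign_all_up mulr1 subr0. Qed.

Lemma le_jump s : `|jump s| <= 2 ^+ n.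
Proof.
have h : 1 <= 2 ^+ n :> R by rewrite exprn_ege1// ler1n.
by rewrite /jump; case: (s == all_up); rewrite ?mulr1n ?mulr0n ler_norml; lra.
Qed.

Lemma le_step_jump Q x : `|step Q jump x| <= 2 ^+ n * \1_(points Q) x.
Proof.
by rewrite /step normrM mulrC indicE normr_nat ler_wpM2r ?le_jump.
Qed.

Lemma Rintegral_jump Q : \int[mu]_x step Q jump x = 0.
Proof. by rewrite Rintegral_step sum_jump mulr0. Qed.

End step.

(** * Orthogonality and the square function estimate *)

Section integrable_step_mul.
Context {R : realType} {n : nat}.
Implicit Types (P Q : cube R n) (v w : {ffun 'I_n -> bool} -> R).
Local Notation mu := (lebesgue_Rn n).

Lemma integrable_cst_cube Q (c : R) : mu.-integrable (points Q) (EFin \o (fun=> c)).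
Proof.
apply: (le_integrable _ _ _ (integrableZl _ c (integrable_cube Q _))) => //.
  by apply/measurable_EFinP; exact: measurable_cst.
by move=> x Qx /=; rewrite lee_fin indicE mem_set// mulr1.
Qed.

Lemma integrable_mul_bounded (A : set (n.-tuple R)) (f h : n.-tuple R -> R) (C : R) :
  measurable A -> measurable_fun setT h -> (forall x, `|h x| <= C) ->
  mu.-integrable A (EFin \o f) -> mu.-integrable A (EFin \o (fun x => f x * h x)).
Proof.
move=> mA mh hC intf; have C0 : 0 <= C by exact: le_trans (hC [tuple of nseq n 0]).
apply: (le_integrable mA _ _ (integrableZl mA C intf)).
  apply/measurable_EFinP; apply: measurable_funM.
    by apply/measurable_EFinP; exact: (measurable_int _ intf).
  exact: measurable_funS mh.
move=> x _ /=; rewrite lee_fin !normrM mulrC ler_wpM2r//.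
by rewrite (ger0_norm C0).
Qed.

Lemma step_bounded Q v : exists C, forall x, `|step Q v x| <= C.
Proof.
exists (\sum_s `|v s|) => x; rewrite /step normrM indicE.
rewrite (bigD1 (half_of Q x))//= normr_nat.
have : 0 <= \sum_(s | s != half_of Q x) `|v s| by apply: sumr_ge0.
by have := normr_ge0 (v (half_of Q x)); case: (_ \in _); rewrite /= ?mul1r ?mul0r; lra.
Qed.

Lemma integrable_mul_step (A : set (n.-tuple R)) (f : n.-tuple R -> R) Q v :
  measurable A -> mu.-integrable A (EFin \o f) ->
  mu.-integrable A (EFin \o (fun x => f x * step Q v x)).
Proof.
move=> mA intf; have [C hC] := step_bounded Q v.
by apply: (integrable_mul_bounded mA _ hC) => //; exact: measurable_step.
Qed.

End integrable_step_mul.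

Section jumps.
Context {R : realType} {n : nat}.
Hypothesis hn : (0 < n)%N.
Variable D : set (cube R n).
Hypothesis hD : dyadic_grid D.
Implicit Types (P Q : cube R n) (F : set (cube R n)).
Implicit Types (v w : {ffun 'I_n -> bool} -> R).
Local Notation mu := (lebesgue_Rn n).

(** On a cube of the grid strictly inside [Q], any function that is constant on the halves of
[Q] is constant, and [jump] has mean zero. *)
Lemma jump_step_orthogonal P Q w : D P -> D Q -> points P `<=` points Q ->
  P != Q -> \int[mu]_x (step P jump x * step Q w x) = 0.
Proof.
move=> DP DQ PQ nPQ; have [s Ps] := grid_in_child hn hD DP DQ PQ nPQ.
under eq_Rintegral do rewrite (step_childM _ _ _ Ps).
rewrite RintegralZl//; last exact: integrable_step.
by rewrite Rintegral_jump mulr0.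
Qed.

Lemma jump_orthogonal P Q : D P -> D Q -> P != Q ->
  \int[mu]_x (step P jump x * step Q jump x) = 0.
Proof.
move=> DP DQ nPQ.
have [PQ0|/set0P[x [Px Qx]]] := eqVneq (points P `&` points Q) set0.
  by rewrite /Rintegral integral0_eq// => x _; rewrite step_disjM.
have [PQ|/ltW QP] := leP P.2 Q.2.
  by apply: jump_step_orthogonal => //; exact: (grid_sub hn hD DP DQ PQ Px Qx).
under eq_Rintegral do rewrite mulrC.
by apply: jump_step_orthogonal; rewrite 1?eq_sym//; exact: (grid_sub hn hD DQ DP QP Qx Px).
Qed.

Definition jumps F x : R := \sum_(P \in F) step P jump x.

Lemma jumpsE F x : finite_set F ->
  jumps F x = \sum_(P <- fset_set F) step P jump x.
Proof. by move=> finF; rewrite /jumps fsbig_finite. Qed.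

Lemma measurable_jumps F : finite_set F -> measurable_fun setT (jumps F).
Proof.
move=> finF; rewrite (_ : jumps F = fun x => \sum_(P <- fset_set F) step P jump x).
  by apply: measurable_sum => P; exact: measurable_step.
by apply/funext => x; exact: jumpsE.
Qed.

Lemma integrable_jumps (A : set (n.-tuple R)) F : measurable A -> finite_set F ->
  mu.-integrable A (EFin \o jumps F).
Proof.
move=> mA finF; rewrite (_ : jumps F = fun x => \sum_(P <- fset_set F) step P jump x).
  by apply: integrable_Rsum => // P; exact: integrable_step.
by apply/funext => x; exact: jumpsE.
Qed.

Lemma jumps_out F Q x : F `<=` [set P | points P `<=` points Q] ->
  ~ points Q x -> jumps F x = 0.
Proof.
move=> FQ nQx; rewrite /jumps fsbig1// => P FP; rewrite step_out//.
by move=> /(FQ _ FP).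
Qed.

Lemma integrable_jumpsM (A : set (n.-tuple R)) F (f : n.-tuple R -> R) :
  measurable A -> finite_set F -> mu.-integrable A (EFin \o f) ->
  mu.-integrable A (EFin \o (fun x => f x * jumps F x)).
Proof.
move=> mA finF intf.
rewrite (_ : (fun x => _) = fun x => \sum_(P <- fset_set F) (f x * step P jump x)).
  by apply: integrable_Rsum => // P; exact: integrable_mul_step.
by apply/funext => x; rewrite jumpsE// mulr_sumr.
Qed.

(** Only the diagonal terms of the expanded square survive. *)
Lemma Rintegral_jumps_sqr F : finite_set F -> F `<=` D ->
  \int[mu]_x (jumps F x * jumps F x) = (2 ^+ n - 1) * \sum_(P \in F) vol P.
Proof.
move=> finF FD.
transitivity (\sum_(P <- fset_set F) \sum_(Q <- fset_set F)
    \int[mu]_x (step P jump x * step Q jump x)).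
  under eq_Rintegral do rewrite jumpsE// mulr_suml.
  rewrite Rintegral_sum//; last first.
    move=> P; under eq_fun do rewrite -jumpsE//.
    by apply: integrable_jumpsM => //; exact: integrable_step.
  apply: eq_bigr => P _; under eq_Rintegral do rewrite mulr_sumr.
  rewrite Rintegral_sum// => Q.
  by apply: integrable_mul_step => //; exact: integrable_step.
rewrite fsbig_finite// mulr_sumr big_seq [RHS]big_seq; apply: eq_bigr => P FP.
rewrite (bigD1_seq P)//= big_seq_cond big1 ?addr0; last first.
  move=> Q /andP[FQ nQP]; apply: jump_orthogonal; rewrite 1?eq_sym//.
    by apply: FD; apply/set_mem; rewrite -in_fset_set.
  by apply: FD; apply/set_mem; rewrite -in_fset_set.
under eq_Rintegral do rewrite stepM.
rewrite Rintegral_step sum_jump_sqr mulrA divfK ?expf_neq0 ?pnatr_eq0//.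
by rewrite mulrC.
Qed.

Lemma Rintegral_support (A : set (n.-tuple R)) (f : n.-tuple R -> R) :
  (forall x, ~ A x -> f x = 0) -> \int[mu]_(x in A) f x = \int[mu]_x f x.
Proof.
move=> f0; rewrite Rintegral_mkcond; apply: eq_Rintegral => x _.
by rewrite patchE; case: ifPn => // /negP nA; rewrite f0// => Ax; apply/nA/mem_set.
Qed.

Lemma Rintegral_jumps F Q : finite_set F ->
  F `<=` [set P | points P `<=` points Q] ->
  \int[mu]_(x in points Q) jumps F x = 0.
Proof.
move=> finF FQ; rewrite Rintegral_support; last first.
  by move=> x; exact: jumps_out FQ.
under eq_Rintegral do rewrite jumpsE//.
rewrite Rintegral_sum//; last by move=> P; exact: integrable_step.
by rewrite big1// => P _; exact: Rintegral_jump.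
Qed.

(** Cauchy-Schwarz in the form [|g| <= (t + g^2 / t) / 2], with the value of [t]
that balances the two terms. *)
Lemma Rintegral_abs_jumps F Q (L : R) : finite_set F -> F `<=` D ->
  F `<=` [set P | points P `<=` points Q] ->
  0 < L -> \sum_(P \in F) vol P <= L * vol Q ->
  \int[mu]_(x in points Q) `|jumps F x| <= Num.sqrt ((2 ^+ n - 1) * L) * vol Q.
Proof.
move=> finF FD FQ L0 volF; set t := Num.sqrt _.
have n1 : 0 < 2 ^+ n - 1 :> R by rewrite subr_gt0 exprn_egt1 ?ltr1n -?lt0n.
have tt : t * t = (2 ^+ n - 1) * L by rewrite -expr2 sqr_sqrtr// mulr_ge0 ?ltW.
have t0 : 0 < t by rewrite sqrtr_gt0 mulr_gt0.
have intg : mu.-integrable (points Q) (EFin \o jumps F).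
  exact: integrable_jumps.
have intgg : mu.-integrable (points Q) (EFin \o (fun x => jumps F x * jumps F x)).
  exact: integrable_jumpsM.
have intt : mu.-integrable (points Q) (EFin \o (fun=> t)).
  exact: integrable_cst_cube.
have int2 : mu.-integrable (points Q)
    (EFin \o (fun x => t^-1 * (jumps F x * jumps F x))).
  exact: (integrableZl _ _ intgg).
have int3 : mu.-integrable (points Q)
    (EFin \o (fun x => t + t^-1 * (jumps F x * jumps F x))).
  exact: (integrableD _ intt int2).
apply: (@le_trans _ _ (\int[mu]_(x in points Q)
    (2^-1 * (t + t^-1 * (jumps F x * jumps F x))))).
  apply: le_Rintegral => //; first exact: integrable_norm.
    exact: (integrableZl _ _ int3).
  move=> x _; rewrite -(ler_pM2l t0) mulrCA mulrDr (mulrA t) mulfV ?gt_eqF// mul1r.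
  have := sqr_ge0 (`|jumps F x| - t).
  rewrite sqrrB real_normK ?num_real// !expr2; nra.
rewrite RintegralZl//.
rewrite RintegralD// Rintegral_cst// RintegralZl//.
rewrite (Rintegral_support (f := fun x => jumps F x * jumps F x)); last first.
  by move=> x nQx; rewrite (jumps_out FQ nQx) mulr0.
rewrite Rintegral_jumps_sqr// -/(vol Q).
have : t^-1 * ((2 ^+ n - 1) * \sum_(P \in F) vol P) <= t * vol Q.
  rewrite ler_pdivrMl// mulrA tt -mulrA ler_pM2l//.
lra.
Qed.

End jumps.

(** * The function attached to a sparse family *)

Section sparse.
Context {R : realType} {n : nat}.
Hypothesis hn : (0 < n)%N.
Variables (D S : set (cube R n)) (L : R).
Hypothesis hD : dyadic_grid D.
Hypothesis hSD : S `<=` D.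
Hypothesis hL : 1 < L.
Hypothesis hS : carleson D S L.
Hypothesis hchain : ~ has_increasing_chain S.
Implicit Types (P Q : cube R n) (F : set (cube R n)).
Local Notation mu := (lebesgue_Rn n).
Local Notation b := (btilde S).

Let below Q := [set P | S P /\ points P `<=` points Q].
Let above Q := [set P | [/\ S P, points Q `<=` points P & P != Q]].

Lemma sparse_countable : countable S.
Proof.
by apply: sub_countable (grid_countable hD); exact: subset_card_le.
Qed.

Lemma measurable_btilde : measurable_fun setT b.
Proof.
apply: (measurable_fun_rsum sparse_countable (u := fun P x => btilde_term x P)).
move=> P _; rewrite (_ : (fun x => _) = step P jump); first exact: measurable_step.
by apply/funext => x; exact: btilde_step.
Qed.

Lemma below_or_above P Q x : S P -> D Q -> points P x -> points Q x ->
  below Q P \/ above Q P.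
Proof.
move=> SP DQ Px Qx; have DP := hSD SP.
have [PQ|/ltW QP] := leP P.2 Q.2.
  by left; split => //; exact: (grid_sub hn hD DP DQ PQ Px Qx).
have [PQ|PQ] := eqVneq P Q; first by left; split => //; rewrite PQ.
by right; split => //; exact: (grid_sub hn hD DQ DP QP Qx Px).
Qed.

Lemma sum_vol_below F Q : D Q -> finite_set F -> F `<=` below Q ->
  \sum_(P \in F) vol P <= L * vol Q.
Proof.
move=> DQ finF FQ; rewrite -lee_fin -fsumEFin//.
by apply: le_trans (hS DQ); apply: esum_ge; exists F.
Qed.

(** The cubes of [S] strictly containing [Q] are finitely many and contribute a
constant on [Q]; those not meeting [Q] contribute nothing; and the remaining
ones form a series converging in mean, by the Carleson condition. *)
Lemma btilde_approx Q (e : R) : D Q -> 0 < e -> exists F c,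
  [/\ finite_set F, F `<=` below Q, (S Q -> F Q) &
    (\int[mu]_(x in points Q) `|b x - (c + jumps F x)|%:E <= e%:E)%E].
Proof.
move=> DQ e0; pose N : R := 2 ^+ n; have N0 : 0 < N by rewrite exprn_gt0.
(* [F0] forces the finite set to contain [Q] whenever [Q] is in [S]. *)
pose F0 := [set P | P = Q /\ S Q].
have finF0 : finite_set F0 by apply: (@sub_finite_set _ _ [set Q]) => [P []|].
have F0Q : F0 `<=` below Q by move=> P [-> SQ]; split.
have [F [finF F0F FQ tail]] : exists G,
    [/\ finite_set G, F0 `<=` G, G `<=` below Q &
    (\esum_(P in below Q `\` G) (vol P)%:E <= (e / N)%:E)%E].
  apply: esum_tail => //.
  - by move=> P; rewrite lee_fin ltW// vol_gt0.
  - by move=> P; exact: ltry.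
  - by apply: (le_lt_trans (hS DQ)); exact: ltry.
  - by rewrite divr_gt0.
have finA : finite_set (above Q) by exact: (finite_above hn hD hSD hchain DQ).
pose c := \sum_(P \in above Q) step P jump Q.1.
have cE x : points Q x -> \sum_(P \in above Q) btilde_term x P = c.
  move=> Qx; apply: eq_fsbigr => P /set_mem[SP QP PQ]; rewrite btilde_step.
  have [s Qs] : exists s, points Q `<=` points (child P s).
    by apply: (grid_in_child hn hD DQ (hSD SP) QP); rewrite eq_sym.
  have /points_childP[Px xs] := Qs _ Qx.
  have /points_childP[Pq qs] := Qs _ (corner_in Q).
  by rewrite !step_in// xs qs.
have FA : F `&` above Q = set0.
  apply/seteqP; split => // P [/FQ[SP PQ] [_ QP nPQ]].
  have := grid_lt hn hD (hSD SP) DQ PQ nPQ; apply/negP; rewrite -leNgt.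
  by apply/ltW/(grid_lt hn hD DQ (hSD SP) QP); rewrite eq_sym.
have pointwise x : points Q x -> (`|b x - (c + jumps F x)|%:E <=
    N%:E * \esum_(P in below Q `\` F) (\1_(points P) x)%:E)%E.
  move=> Qx; have FAS : F `|` above Q `<=` S.
    by move=> P [/FQ[]|[]].
  have finFA : finite_set (F `|` above Q) by rewrite finite_setU.
  have := rsum_approx (btilde_term x) finFA FAS.
  rewrite fsbigU//=; last by rewrite FA.
  rewrite cE// (eq_fsbigr (step^~ jump^~ x)); last first.
    by move=> P _; exact: btilde_step.
  rewrite addrC => /le_trans; apply.
  apply: le_trans (le_esumZ _ _ (ltW N0)); last by move=> P; rewrite lee_fin.
  rewrite [leLHS]esum_mkcond [leRHS]esum_mkcond; apply: le_esum => P _.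
  case: ifPn => [/set_mem[SP /not_orP[nFP nAP]]|_]; last first.
    by case: ifP => // _; rewrite -EFinM lee_fin mulr_ge0 ?(ltW N0).
  case: ifPn => [_|/negP nP].
    by rewrite btilde_step -EFinM lee_fin; exact: le_step_jump.
  rewrite btilde_step step_out ?normr0// => Px; apply: nP; apply/mem_set.
  by have [|] := below_or_above SP DQ Px Qx.
exists F, c; split => //; first by move=> SQ; apply: F0F.
have cbelow : countable (below Q `\` F).
  apply: sub_countable sparse_countable; apply: subset_card_le.
  by move=> P [[]].
apply: (@le_trans _ _ (\int[mu]_(x in points Q)
    (N%:E * \esum_(P in below Q `\` F) (\1_(points P) x)%:E))%E).
  apply: ge0_le_integral => //.
  - apply/measurable_EFinP; apply: measurableT_comp => //.
    apply: measurable_funB; first exact: measurable_funS measurable_btilde.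
    apply: measurable_funD => //.
    exact: measurable_funS (measurable_jumps finF).
  - apply: measurable_funeM; apply: measurable_fun_esum => // P _.
    by apply/measurable_EFinP; apply: measurable_indic.
rewrite ge0_integralZl//; last 3 first.
- apply: measurable_fun_esum => // P _.
  by apply/measurable_EFinP; apply: measurable_indic.
- by move=> x _; apply: esum_ge0 => P _; rewrite lee_fin.
- by rewrite lee_fin ltW.
rewrite ge0_integral_esum//; last first.
  by move=> P _; apply/measurable_EFinP; apply: measurable_indic.
rewrite -[leRHS](_ : N%:E * (e / N)%:E = _)%E; last first.
  by rewrite -EFinM mulrC divfK ?gt_eqF.
apply: lee_wpmul2l; first by rewrite lee_fin ltW.
apply: le_trans tail.
apply: le_esum => P _; rewrite integral_indic// -[leRHS]mu_vol.
by apply: le_measure; [apply/mem_set; apply: measurableI|exact/mem_set|].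
Qed.

Lemma integrable_btilde Q : D Q -> mu.-integrable (points Q) (EFin \o b).
Proof.
move=> DQ; have [F [c [finF FQ _ bF]]] := btilde_approx DQ ltr01.
have intd : mu.-integrable (points Q) (EFin \o (fun x => b x - (c + jumps F x))).
  apply/integrableP; split; last by apply: (le_lt_trans bF); exact: ltry.
  apply/measurable_EFinP; apply: measurable_funB.
    exact: measurable_funS measurable_btilde.
  apply: measurable_funD => //; exact: measurable_funS (measurable_jumps finF).
have intg : mu.-integrable (points Q) (EFin \o jumps F) by exact: integrable_jumps.
have := integrableD _ intd (integrableD _ (integrable_cst_cube Q c) intg).
move=> /(_ (measurable_points Q) (measurable_points Q)).
by apply: eq_integrable => // x _ /=; rewrite -!EFinD subrK.
Qed.

Lemma btilde_Rapprox Q (e : R) : D Q -> 0 < e -> exists F c,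
  [/\ finite_set F, F `<=` below Q, (S Q -> F Q),
    mu.-integrable (points Q) (EFin \o (fun x => b x - (c + jumps F x))) &
    \int[mu]_(x in points Q) `|b x - (c + jumps F x)| <= e].
Proof.
move=> DQ e0; have [F [c [finF FQ FS bF]]] := btilde_approx DQ e0.
have intd : mu.-integrable (points Q) (EFin \o (fun x => b x - (c + jumps F x))).
  have intg : mu.-integrable (points Q) (EFin \o jumps F).
    exact: integrable_jumps.
  have intc := integrable_cst_cube Q c.
  exact: (integrableB _ (integrable_btilde DQ) (integrableD _ intc intg)).
exists F, c; split => //.
rewrite -lee_fin /Rintegral fineK//.
exact: integrable_fin_num (integrable_norm intd).
Qed.

(** The mean of [b] over [Q] is the contribution of the cubes above [Q], so the
oscillation of [b] over [Q] is the mean size of the jumps inside [Q]. *)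
Lemma Rintegral_oscillation Q : D Q ->
  \int[mu]_(x in points Q) `|b x - avg b Q|
    <= Num.sqrt ((2 ^+ n - 1) * L) * vol Q.
Proof.
move=> DQ; apply/ler_addgt0Pr => e e0.
have e20 : 0 < e / 2 by rewrite divr_gt0.
have [F [c [finF FQ _ intd bF]]] := btilde_Rapprox DQ e20.
have intg : mu.-integrable (points Q) (EFin \o jumps F) by exact: integrable_jumps.
have intc k := integrable_cst_cube Q k.
have FQ' : F `<=` [set P | points P `<=` points Q] by move=> P /FQ[].
have FD : F `<=` D by move=> P /FQ[/hSD].
have v0 := vol_gt0 Q.
pose d x := b x - (c + jumps F x).
have avgE : avg b Q = c + (vol Q)^-1 * \int[mu]_(x in points Q) d x.
  rewrite /avg (@eq_Rintegral _ _ _ _ _ (fun x => d x + (c + jumps F x))); last first.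
    by move=> x _; rewrite /d subrK.
  rewrite RintegralD//; last exact: (integrableD _ (intc c) intg).
  rewrite RintegralD// Rintegral_cst// Rintegral_jumps// addr0 -/(vol Q).
  by rewrite mulrDr addrC mulrCA mulVf ?mulr1 ?gt_eqF.
have davg : `|c - avg b Q| * vol Q <= e / 2.
  rewrite avgE opprD addrA subrr sub0r normrN normrM gtr0_norm ?invr_gt0//.
  rewrite mulrC mulrA mulfV ?gt_eqF// mul1r.
  exact: le_trans (le_normr_Rintegral _ intd) bF.
have intnd := integrable_norm intd.
have intng := integrable_norm intg.
apply: (@le_trans _ _ (\int[mu]_(x in points Q)
    (`|d x| + (`|jumps F x| + `|c - avg b Q|)))).
  apply: le_Rintegral => //.
  - exact: (integrable_norm (integrableB _ (integrable_btilde DQ) (intc _))).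
  - exact: (integrableD _ intnd (integrableD _ intng (intc _))).
  move=> x _; have -> : b x - avg b Q = d x + (jumps F x + (c - avg b Q)).
    by rewrite /d; ring.
  by rewrite (le_trans (ler_normD _ _))// lerD2l ler_normD.
rewrite RintegralD//; last exact: (integrableD _ intng (intc _)).
rewrite RintegralD// Rintegral_cst// -/(vol Q).
have L0 : 0 < L by exact: lt_trans ltr01 hL.
have := Rintegral_abs_jumps hn hD finF FD FQ' L0 (sum_vol_below DQ finF FQ).
lra.
Qed.

Lemma bmo_norm_btilde :
  (bmo_norm D b <= (Num.sqrt ((2 ^+ n - 1) * L))%:E)%E.
Proof.
apply: ge_ereal_sup => _ [Q DQ <-].
have intd : mu.-integrable (points Q) (EFin \o (fun x => b x - avg b Q)).
  exact: (integrableB _ (integrable_btilde DQ) (integrable_cst_cube Q _)).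
rewrite -[X in (_ * X)%E]fineK; last first.
  exact: integrable_fin_num (integrable_norm intd).
by rewrite -EFinM lee_fin ler_pdivrMl ?vol_gt0// mulrC Rintegral_oscillation.
Qed.

(** Of the series that defines [b], only the term of [Q] itself is not
orthogonal to a cancellative Haar function of [Q]. *)
Lemma inner_btilde_haar Q (e : {ffun 'I_n -> bool}) : D Q -> cancellative e ->
  inner b (haar Q e) = if `[< S Q >] then Num.sqrt (vol Q) else 0.
Proof.
move=> DQ ec; pose h := haar Q e.
pose w s : R := (Num.sqrt (vol Q))^-1 * haar_sign e s.
have q0 : 0 < Num.sqrt (vol Q) by rewrite sqrtr_gt0 vol_gt0.
have hE : h = step Q w by apply/funext => x; exact: haar_step.
have -> : inner b h = \int[mu]_(x in points Q) (b x * h x).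
  by rewrite Rintegral_support// => x nQx; rewrite hE step_out ?mulr0.
apply/eqP; rewrite -subr_eq0 -normr_le0; apply/ler_addgt0Pr => eps eps0.
(* The Haar function is bounded by [C], so an error [eps / (C + 1)] on [b] costs
   less than [eps]. *)
have [C hC] := step_bounded Q w.
have C0 : 0 <= C by exact: le_trans (hC Q.1).
have e'0 : 0 < eps / (C + 1) by rewrite divr_gt0//; lra.
have [F [c [finF FQ FS intd bF]]] := btilde_Rapprox DQ e'0.
have FQ' : F `<=` [set P | points P `<=` points Q] by move=> P /FQ[].
have FD : F `<=` D by move=> P /FQ[/hSD].
pose d x := b x - (c + jumps F x).
have intg : mu.-integrable (points Q) (EFin \o jumps F) by exact: integrable_jumps.
have inth : mu.-integrable (points Q) (EFin \o step Q w) by exact: integrable_step.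
have intdh : mu.-integrable (points Q) (EFin \o (fun x => d x * step Q w x)).
  exact: integrable_mul_step.
have intgh : mu.-integrable (points Q) (EFin \o (fun x => jumps F x * step Q w x)).
  exact: integrable_mul_step.
have intch : mu.-integrable (points Q) (EFin \o (fun x => c * step Q w x)).
  exact: (integrableZl _ _ inth).
have -> : \int[mu]_(x in points Q) (b x * h x) =
    \int[mu]_(x in points Q) (d x * step Q w x) +
    (if `[< S Q >] then Num.sqrt (vol Q) else 0).
  rewrite (@eq_Rintegral _ _ _ _ _ (fun x => d x * step Q w x +
      (c * step Q w x + jumps F x * step Q w x))); last first.
    by move=> x _; rewrite hE /d; ring.
  rewrite RintegralD//; last exact: (integrableD _ intch intgh).
  rewrite RintegralD// RintegralZl//; congr (_ + _).
  rewrite Rintegral_step_sub// Rintegral_step.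
  rewrite -mulr_sumr sum_haar_sign// !mulr0 add0r.
  rewrite Rintegral_support; last by move=> x nQx; rewrite step_out ?mulr0.
  under eq_Rintegral do rewrite jumpsE// mulr_suml.
  rewrite Rintegral_sum//; last first.
    by move=> P; apply: integrable_mul_step => //; exact: integrable_step.
  have zero P : P \in fset_set F -> P != Q ->
      \int[mu]_x (step P jump x * step Q w x) = 0.
    move=> FP PQ; have {}FP : F P by apply/set_mem; rewrite -in_fset_set.
    exact: (jump_step_orthogonal hn hD w (FD _ FP) DQ (FQ' _ FP) PQ).
  case: asboolP => SQ; last first.
    rewrite big_seq big1// => P FP; apply: zero => //; apply/eqP => PQ.
    apply: SQ; rewrite -PQ; suff /FQ[] : F P by [].
    by apply/set_mem; rewrite -in_fset_set.
  rewrite (bigD1_seq Q) ?fset_uniq//=; last by rewrite in_fset_set//; exact/mem_set/FS.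
  rewrite big_seq_cond big1 ?addr0; last by move=> P /andP[]; exact: zero.
  under eq_Rintegral do rewrite stepM.
  rewrite Rintegral_step.
  have -> : \sum_s jump s * w s = (Num.sqrt (vol Q))^-1 * 2 ^+ n.
    rewrite -(sum_jump_haar_sign ec) mulr_sumr; apply: eq_bigr => s _.
    by rewrite /w mulrCA.
  have N0 : (2 : R) ^+ n != 0 by rewrite expf_neq0 ?pnatr_eq0.
  rewrite mulrCA divfK// -[X in _ * X](sqr_sqrtr (ltW (vol_gt0 Q))).
  by rewrite expr2 mulrA mulVf ?mul1r ?gt_eqF.
rewrite addrK; apply: le_trans (le_normr_Rintegral _ intdh) _ => //.
apply: (@le_trans _ _ (\int[mu]_(x in points Q) (C * `|d x|))).
  apply: le_Rintegral => //; first exact: integrable_norm.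
    exact: (integrableZl _ _ (integrable_norm intd)).
  by move=> x _; rewrite normrM mulrC ler_wpM2r.
rewrite RintegralZl//; last exact: integrable_norm.
apply: (@le_trans _ _ (C * (eps / (C + 1)))); first by rewrite ler_wpM2l.
rewrite add0r mulrCA ger_pMr// ler_pdivrMr ?mul1r; lra.
Qed.

(** Each of the [2 ^ n - 1] cancellative Haar functions of a cube of [S]
contributes [sqrt (vol Q) * sqrt (vol Q) / vol Q = 1]. *)
Lemma paraprod2_btilde f x Q : D Q -> paraprod2_term b b f x Q =
  if `[< S Q >] then (2 ^+ n - 1) * sparse_term f x Q else 0.
Proof.
move=> DQ; rewrite /paraprod2_term.
rewrite (eq_bigr (fun=> if `[< S Q >] then sparse_term f x Q else 0)); last first.
  move=> e ec; rewrite inner_btilde_haar//; case: ifP => _; last by rewrite !mul0r.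
  rewrite -expr2 sqr_sqrtr ?ltW ?vol_gt0// /sparse_term.
  have v0 : vol Q != 0 by rewrite gt_eqF ?vol_gt0.
  by field.
rewrite sumr_const -[LHS]mulr_natl; case: ifP => _; last by rewrite mulr0.
by rewrite -card_cancellative.
Qed.

(** The number of cubes of [S] inside [Q] that contain a given point has integral
at most [L * vol Q] over [Q], so it is finite almost everywhere there; the cubes above [Q] are
finitely many. *)
Lemma ae_finite_below Q : D Q -> {ae mu, forall x, points Q x ->
  finite_set [set P | S P /\ points P x]}.
Proof.
move=> DQ; have cbelow : countable (below Q).
  apply: sub_countable sparse_countable; apply: subset_card_le.
  by move=> P [].
have ind P : below Q P ->
    measurable_fun (points Q) (fun x => (\1_(points P) x : R)%:E).
  by move=> _; apply/measurable_EFinP; apply: measurable_indic.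
have intN : mu.-integrable (points Q)
    (fun x => \esum_(P in below Q) (\1_(points P) x)%:E).
  apply/integrableP; split; first exact: measurable_fun_esum.
  rewrite (@eq_integral _ _ _ _ _
    (fun x => \esum_(P in below Q) (\1_(points P) x)%:E)); last first.
    by move=> x _; rewrite gee0_abs// esum_ge0// => P _; rewrite lee_fin.
  rewrite ge0_integral_esum//.
  apply: le_lt_trans (le_lt_trans (hS DQ) (ltry _)).
  apply: le_esum => P [SP PQ]; rewrite integral_indic// -[leRHS]mu_vol.
  by apply: le_measure; [apply/mem_set; apply: measurableI|exact/mem_set|].
apply: filterS (integrable_ae _ intN) => // x fin Qx.
have finB : finite_set [set P | below Q P /\ points P x].
  by apply: (@finite_esum_indic R); rewrite ltey_eq fin.
have finA : finite_set (above Q) by exact: (finite_above hn hD hSD hchain DQ).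
apply: (@sub_finite_set _ _ ([set P | below Q P /\ points P x] `|` above Q)).
  move=> P [SP Px].
  by have [|] := below_or_above SP DQ Px Qx; [left|right].
by rewrite finite_setU.
Qed.

Lemma ae_finite : {ae mu, forall x, finite_set [set P | S P /\ points P x]}.
Proof.
have /countable_injP[code cinj] := grid_countable hD.
have : {ae mu, forall x k, forall Q, D Q -> code Q = k -> points Q x ->
    finite_set [set P | S P /\ points P x]}.
  apply: ae_foralln => k.
  (* At most one cube has code [k]. *)
  have [[Q [DQ Qk]]|noQ] := pselect (exists Q, D Q /\ code Q = k).
    apply: filterS (ae_finite_below DQ) => x fin Q' DQ' Q'k.
    suff -> : Q' = Q by [].
    by apply: cinj; rewrite ?Qk//; exact/mem_set.
  by apply: aeW => x Q DQ Qk; case: noQ; exists Q.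
apply: filterS => x fin; have [Q [DQ _ Qx]] := grid_cover hD 0 x.
exact: fin DQ erefl Qx.
Qed.

Lemma compact_coord_bounded (K : set 'rV[R]_n) : compact K ->
  exists N : nat, forall x : n.-tuple R, K (\row_i tnth x i) ->
    forall i, `|tnth x i| <= N%:R.
Proof.
move=> /compact_bounded[M [_ MK]].
exists (Num.truncn `|M|).+1 => x Kx i.
have MN : M < (Num.truncn `|M|).+1%:R.
  exact: le_lt_trans (ler_norm M) (truncnS_gt _).
apply: le_trans (MK _ MN _ Kx).
rewrite [leRHS]/Num.norm /= mx_normrE; apply/bigmax_geP; right => /=.
by exists (ord0, i); rewrite //= mxE.
Qed.

(** A compact set is covered by finitely many unit cubes of the grid, and [b] is
integrable over each of them. *)
Lemma loc_integrable_btilde : loc_integrable b.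
Proof.
split; first by exists b; [exact: measurable_btilde|exact: aeW].
move=> K /compact_coord_bounded[N KN].
pose G : set (cube R n) := [set Q | [/\ D Q, Q.2 = 0 &
  exists2 x, points Q x & forall i, `|tnth x i| <= N%:R]].
have finG : finite_set G by exact: grid_finite_meet.
rewrite integral_mkcond.
apply: (@le_lt_trans _ _ (\int[mu]_x (\sum_(Q \in G)
    (((fun y => `|b y|%:E) \_ (points Q)) x)))%E).
  apply: ge0_le_integralT => x; first by rewrite patchE; case: ifP.
  have ge0 Q : (0 <= ((fun y => `|b y|%:E) \_ (points Q)) x)%E.
    by rewrite patchE; case: ifP.
  rewrite [leLHS]patchE; case: ifPn => [/set_mem Kx|_]; last exact: fsume_ge0.
  have [Q [DQ Q0 Qx]] := grid_cover hD 0 x.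
  have GQ : G Q by split => //; exists x => //; exact: KN.
  rewrite (fsbigD1 Q)//= patchE ifT; last exact/mem_set.
  by rewrite leeDl// fsume_ge0.
rewrite ge0_integral_fsum//.
- rewrite fsbig_finite// big_seq; apply: lte_sum_pinfty => Q; rewrite in_fset_set//.
  move=> /set_mem[DQ _ _]; rewrite -integral_mkcond.
  by have /integrableP[] := integrable_btilde DQ.
- move=> Q; apply/(measurable_restrictT _ _).1 => //.
  apply/measurable_EFinP; apply: measurableT_comp => //.
  exact: measurable_funS measurable_btilde.
- by move=> Q x _; rewrite patchE; case: ifP.
Qed.

End sparse.

Theorem mainTheorem8 (R : realType) (n : nat) (hn : (0 < n)%N)
    (D S : set (cube R n)) (Lambda : R)
    (hD : dyadic_grid D) (hSD : S `<=` D)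
    (hLambda : 1 < Lambda) (hS : carleson D S Lambda)
    (hchain : ~ has_increasing_chain S) :
  [/\ {ae lebesgue_Rn n, forall x, summable S (EFin \o btilde_term x)},
      bmo D (btilde S),
      (bmo_norm D (btilde S) <= (Num.sqrt ((2 ^+ n - 1) * Lambda))%:E)%E
    & forall f : n.-tuple R -> R, loc_integrable f ->
      {ae lebesgue_Rn n, forall x,
        [/\ summable S (EFin \o sparse_term f x),
            summable D (EFin \o paraprod2_term (btilde S) (btilde S) f x)
          & sparse_op S f x =
            (2 ^+ n - 1)^-1 * paraprod2 D (btilde S) (btilde S) f x]}].
Proof.
have ae := ae_finite hn hD hSD hS hchain.
have norm := bmo_norm_btilde hn hD hSD hLambda hS hchain.
split => //.
- apply: filterS ae => x fin; apply: (summable_finite fin) => [P []//|P SP nPx].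
  by rewrite btilde_step step_out// => Px; apply: nPx.
- split; first exact: (loc_integrable_btilde hn hD hSD hS hchain).
  by apply: (le_lt_trans norm); exact: ltry.
move=> f _; apply: filterS ae => x fin; set F := [set P | S P /\ points P x] in fin.
have FS : F `<=` S by move=> P [].
have FD : F `<=` D by move=> P /FS/hSD.
have sparse0 P : S P -> ~ F P -> sparse_term f x P = 0.
  move=> SP nFP; rewrite /sparse_term indicE memNset ?mulr0// => Px.
  by apply: nFP.
have para P : D P -> paraprod2_term (btilde S) (btilde S) f x P =
    if `[< S P >] then (2 ^+ n - 1) * sparse_term f x P else 0.
  exact: (paraprod2_btilde hn hD hSD hS hchain).
have para0 P : D P -> ~ F P -> paraprod2_term (btilde S) (btilde S) f x P = 0.
  move=> DP nFP; rewrite para//; case: asboolP => // SP.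
  by rewrite sparse0// mulr0.
split; [exact: summable_finite FS sparse0|exact: summable_finite FD para0|].
rewrite /sparse_op /paraprod2 (rsum_finite fin FS sparse0).
rewrite (rsum_finite fin FD para0) !fsbig_finite// mulr_sumr big_seq [RHS]big_seq.
apply: eq_bigr => P; rewrite in_fset_set// => /set_mem FP.
rewrite para; last exact: FD.
rewrite (asboolT (FS _ FP)) mulKf// gt_eqF// subr_gt0 exprn_egt1 ?ltr1n -?lt0n//.
Qed.
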